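(* Let $X$ be a topological space (not necessarily Tychonoff) and let $\aleph_\alpha$ be an infinite cardinal number. Then there exists a Tychonoff space $Y$ such that $C_{\aleph_\alpha}(X)$ and $C_{\aleph_\alpha}(Y)$ are topologically isomorphic, i.e. there is a ring isomorphism $C(Y)\to C(X)$ that is a homeomorphism from $C_{\aleph_\alpha}(Y)$ onto $C_{\aleph_\alpha}(X)$.
   Context: Tychonoff means completely regular and Hausdorff. For a topological space $X$, $C(X)$ is the ring (pointwise operations) of all real-valued continuous functions on $X$. For an infinite cardinal $\aleph_\alpha$, $\mathcal{A}_{\aleph_\alpha}=\{A\subseteq X: |A|<\aleph_\alpha\}$. For $f\in C(X)$, $A\in\mathcal{A}_{\aleph_\alpha}$ and real $\epsilon>0$ put $B(f,A,\epsilon)=\{g\in C(X): \sup_{x\in A}|f(x)-g(x)|<\epsilon\}$ (equal to $C(X)$ when $A=\emptyset$). The sets $B(f,A,\epsilon)$ form a base of a topology on $C(X)$; $C_{\aleph_\alpha}(X)$ denotes $C(X)$ with this topology. *)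

(* Defs.v *)
From HB Require Import structures.
From mathcomp Require Import all_boot all_order all_algebra.
From mathcomp Require Import all_classical all_reals ereal topology normedtype.

Set Implicit Arguments.
Unset Strict Implicit.
Unset Printing Implicit Defensive.

Import Order.TTheory GRing.Theory Num.Theory numFieldNormedType.Exports.

Local Open Scope classical_set_scope.
Local Open Scope ring_scope.
Local Open Scope card_scope.

(* Cardinals are not objects of the library: an infinite cardinal is given by
   a type K with infinite_set [set: K], and |A| < |K| is card_lt A [set: K]. *)
Definition card_lt (T U : Type) (A : set T) (B : set U) : Prop :=
  A #<= B /\ ~ (B #<= A).

(* Cardinal arithmetic needed to see that the sets B(f, A, eps) form a base:
   for an infinite K, the union of two sets of cardinal < |K| is again such. *)
Section cardinal_arithmetic.

Lemma card_le_relP (T U : Type) (A : set T) (B : set U) :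
  A #<= B <-> exists r : T -> U -> Prop,
    (forall x, A x -> exists2 y, B y & r x y) /\
    (forall x x' y, A x -> A x' -> r x y -> r x' y -> x = x').
Proof.
split=> [/card_leP[f]|[r [rtot rinj]]].
  exists (fun x y => exists a : A, x = val a /\ y = val (f a)); split.
    move=> x Ax; pose a : A := SigSub (mem_set Ax).
    exists (val (f a)); first exact: set_valP.
    by exists a.
  move=> x x' y _ _ [a [-> ->]] [a' [-> /val_inj e]].
  by congr val; apply: (@inj _ _ setT f); rewrite ?inE.
have [A0|/set0P[x0 Ax0]] := eqVneq A set0; first by rewrite A0 card_ge0.
have [y0 By0 _] := rtot _ Ax0.
have /choice[f fP] : forall x, exists y, A x -> B y /\ r x y.
  move=> x; have [Ax|nAx] := pselect (A x); last by exists y0.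
  by have [y By rxy] := rtot _ Ax; exists y.
have finj : {in A &, injective f}.
  move=> x x' /set_mem Ax /set_mem Ax' e.
  have [_ r1] := fP _ Ax; have [_ r2] := fP _ Ax'.
  by apply: (rinj _ _ (f x)) => //; rewrite e.
rewrite -(card_le_eql (inj_card_eq finj)); apply: subset_card_le.
by move=> _ [x Ax <-]; have [] := fP _ Ax.
Qed.

Lemma card_le_comparable (T U : Type) (A : set T) (B : set U) :
  A #<= B \/ B #<= A.
Proof.
pose P (G : set (T * U)) := [/\ forall p, G p -> A p.1 /\ B p.2,
  forall x y y', G (x, y) -> G (x, y') -> y = y' &
  forall x x' y, G (x, y) -> G (x', y) -> x = x'].
have [|G [[GAB Gfun Ginj] Gmax]] := @Zorn_bigcup _ P.
  move=> F FP Ftot; split.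
  - by move=> p [G /FP[+ _ _]]; apply.
  - move=> x y y' [G FG Gy] [G' FG' Gy'].
    have [sGG'|sG'G] := Ftot _ _ FG FG'.
      by have [_ + _] := FP _ FG'; apply; [exact: sGG' Gy|exact: Gy'].
    by have [_ + _] := FP _ FG; apply; [exact: Gy|exact: sG'G Gy'].
  - move=> x x' y [G FG Gx] [G' FG' Gx'].
    have [sGG'|sG'G] := Ftot _ _ FG FG'.
      by have [_ _] := FP _ FG'; apply; [exact: sGG' Gx|exact: Gx'].
    by have [_ _] := FP _ FG; apply; [exact: Gx|exact: sG'G Gx'].
have [Atot|/existsNP[a /not_implyP[Aa nGa]]] :=
    pselect (forall x, A x -> exists y, G (x, y)).
  left; apply/card_le_relP; exists (fun x y => G (x, y)); split.
    by move=> x /Atot[y Gxy]; exists y => //; have [] := GAB _ Gxy.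
  by move=> x x' y _ _; exact: Ginj.
have [Btot|/existsNP[b /not_implyP[Bb nGb]]] :=
    pselect (forall y, B y -> exists x, G (x, y)).
  right; apply/card_le_relP; exists (fun y x => G (x, y)); split.
    by move=> y /Btot[x Gxy]; exists x => //; have [] := GAB _ Gxy.
  by move=> y y' x _ _; exact: Gfun.
exfalso; apply: (Gmax (G `|` [set (a, b)])).
  split=> [p Gp|]; first by left.
  by move/(_ (a, b) (or_intror erefl)) => Gab; apply: nGa; exists b.
split.
- by move=> p [/GAB//|->].
- move=> x y y' [Gy|[ex ->]] [Gy'|[ex' ->]]//; first exact: Gfun Gy Gy'.
    by exfalso; apply: nGa; exists y; rewrite -ex'.
  by exfalso; apply: nGa; exists y'; rewrite -ex.
- move=> x x' y [Gx|[-> ey]] [Gx'|[-> ey']]//; first exact: Ginj Gx Gx'.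
    by exfalso; apply: nGb; exists x; rewrite -ey'.
  by exfalso; apply: nGb; exists x'; rewrite -ey.
Qed.

(* Zorn's lemma gives a largest D `<=` Q with an injection G of D * bool in D;
   then Q `\` D is finite, whence Q #<= D. *)
Lemma card_le_setU (T U : Type) (A B : set T) (Q : set U) :
  infinite_set Q -> A #<= Q -> B #<= Q -> A `|` B #<= Q.
Proof.
move=> Qinf AQ BQ.
pose dom (G : set (U * bool * U)) := [set x | exists b y, G (x, b, y)].
pose P (G : set (U * bool * U)) := [/\ dom G `<=` Q,
  forall p p' y, G (p, y) -> G (p', y) -> p = p',
  forall p y, G (p, y) -> dom G y &
  forall x b, dom G x -> exists y, G (x, b, y)].
have [|G [[GQ Ginj Gran Gdom] Gmax]] := @Zorn_bigcup _ P.
  move=> F FP Ftot; split.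
  - move=> x [b [y [G FG Gxy]]].
    by have [+ _ _ _] := FP _ FG; apply; exists b, y.
  - move=> p p' y [G FG Gp] [G' FG' Gp'].
    have [sGG'|sG'G] := Ftot _ _ FG FG'.
      by have [_ + _ _] := FP _ FG'; apply; [exact: sGG' Gp|exact: Gp'].
    by have [_ + _ _] := FP _ FG; apply; [exact: Gp|exact: sG'G Gp'].
  - move=> p y [G FG Gp]; have [_ _ + _] := FP _ FG.
    by move=> /(_ _ _ Gp)[b [z Gz]]; exists b, z, G.
  - move=> x b [c [z [G FG Gz]]]; have [_ _ _] := FP _ FG.
    by move=> /(_ x b)[|y Gy]; [exists c, z|exists y, G].
have DU W (X Y : set W) : X #<= dom G -> Y #<= dom G -> X `|` Y #<= dom G.
  move=> /card_le_relP[r [rtot rinj]] /card_le_relP[s [stot sinj]].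
  apply/card_le_relP.
  exists (fun x y => exists z, (X x /\ r x z /\ G (z, true, y)) \/
                              (~ X x /\ s x z /\ G (z, false, y))); split.
    move=> x XYx; have [Xx|nXx] := pselect (X x).
      have [z Gz rxz] := rtot _ Xx; have [y Gy] := Gdom z true Gz.
      by exists y; [exact: Gran Gy|exists z; left].
    have Yx : Y x by case: XYx.
    have [z Gz sxz] := stot _ Yx; have [y Gy] := Gdom z false Gz.
    by exists y; [exact: Gran Gy|exists z; right].
  move=> x x' y XYx XYx' [z [[Xx [rxz Gz]]|[nXx [sxz Gz]]]].
    move=> [z' [[Xx' [rxz' Gz']]|[nXx' [sxz' Gz']]]].
      by have [ez] := Ginj _ _ _ Gz Gz'; apply: (rinj _ _ z); rewrite // ez.
    by have := Ginj _ _ _ Gz Gz'.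
  move=> [z' [[Xx' [rxz' Gz']]|[nXx' [sxz' Gz']]]].
    by have := Ginj _ _ _ Gz Gz'.
  have Yx : Y x by case: XYx.
  have Yx' : Y x' by case: XYx'.
  by have [ez] := Ginj _ _ _ Gz Gz'; apply: (sinj _ _ z); rewrite // ez.
have Ffin : finite_set (Q `\` dom G).
  apply: contrapT => /infiniteP/card_le_relP[r [rtot rinj]].
  have /choice[n nP] : forall k, exists y, (Q `\` dom G) y /\ r k y.
    by move=> k; have [//|y ? ?] := rtot k; exists y.
  have ninj k l : n k = n l -> k = l.
    move=> e; apply: (rinj _ _ (n k)) => //; first by have [] := nP k.
    by rewrite e; have [] := nP l.
  pose N : set (U * bool * U) :=
    [set p | exists k (b : bool), p = (n k, b, n (k.*2 + b)%N)].
  have domN x : dom N x -> exists k, x = n k.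
    by move=> [b [y [k [c [-> _ _]]]]]; exists k.
  have Ndom k : dom N (n k) by exists true, (n (k.*2 + true)%N), k, true.
  have domU x : dom (G `|` N) x -> dom G x \/ dom N x.
    by move=> [b [y [?|?]]]; [left|right]; exists b, y.
  have domGU x : dom G x -> dom (G `|` N) x.
    by move=> [b [y ?]]; exists b, y; left.
  have domNU x : dom N x -> dom (G `|` N) x.
    by move=> [b [y ?]]; exists b, y; right.
  have nG k : ~ dom G (n k) by have [[]] := nP k.
  apply: (Gmax (G `|` N)).
    split=> [p Gp|]; first by left.
    move=> /(_ (n 0%N, true, n 1%N)) GN; apply: (nG 0%N).
    by exists true, (n 1%N); apply: GN; right; exists 0%N, true.
  split.
  - move=> x /domU[/GQ//|/domN[k ->]]; by have [[]] := nP k.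
  - move=> p p' y [Gp|[k [b [-> ->]]]] [Gp'|[l [c [-> e]]]].
    + exact: Ginj Gp Gp'.
    + by have := Gran _ _ Gp; rewrite e => /nG.
    + by have := Gran _ _ Gp' => /nG.
    + have /(congr1 (fun i => (odd i, i./2))) := ninj _ _ e.
      rewrite !oddD !odd_double !oddb /= => -[bc].
      by rewrite addnC half_bit_double addnC half_bit_double bc => ->.
  - move=> p y [Gp|[k [b [_ ->]]]]; last exact/domNU/Ndom.
    exact/domGU/(Gran _ _ Gp).
  - move=> x b /domU[/(Gdom _ b)[y Gy]|/domN[k ->]]; first by exists y; left.
    by exists (n (k.*2 + b)%N); right; exists k, b.
have Qcup : Q = dom G `|` (Q `\` dom G) by rewrite setDUK.
have Dinf : infinite_set (dom G).
  by move=> Dfin; apply: Qinf; rewrite Qcup finite_setU.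
have QD : Q #<= dom G.
  rewrite Qcup; apply: DU; first exact: card_lexx.
  have [//|/card_le_finite] := card_le_comparable (Q `\` dom G) (dom G).
  by move=> /(_ Ffin).
apply: card_le_trans (subset_card_le GQ).
by apply: DU; [exact: card_le_trans AQ QD|exact: card_le_trans BQ QD].
Qed.

Lemma card_lt_setU (T K : Type) (A B : set T) :
  infinite_set [set: K] -> card_lt A [set: K] -> card_lt B [set: K] ->
  card_lt (A `|` B) [set: K].
Proof.
move=> Kinf [AK nKA] [BK nKB].
wlog AB : A B AK nKA BK nKB / A #<= B.
  have [AB|BA] := card_le_comparable A B; first exact.
  by rewrite setUC; apply.
split; first exact: card_le_setU.
move=> KAB; have [Bfin|Binf] := pselect (finite_set B).
  apply: Kinf; apply: (card_le_finite KAB); rewrite finite_setU; split=> //.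
  exact: card_le_finite AB Bfin.
by apply: nKB; apply: card_le_trans KAB (card_le_setU _ _ _).
Qed.

Lemma card_lt_set0 (T K : Type) :
  infinite_set [set: K] -> card_lt (@set0 T) [set: K].
Proof.
move=> Kinf; split; first exact: card_ge0.
by move=> /card_le_finite - /(_ (@finite_set0 _)).
Qed.

End cardinal_arithmetic.

(* C(X), as the library's type of continuous functions, with the pointwise
   operations; it is the zero ring when X is empty. *)
Section ring_of_continuous_functions.
Variables (X : topologicalType) (R : realType).
Implicit Types f g h : continuousType X R.

Let zero_cts : continuous (fun _ : X => 0 : R).
Proof. by move=> x; exact: cvg_cst. Qed.

Let one_cts : continuous (fun _ : X => 1 : R).
Proof. by move=> x; exact: cvg_cst. Qed.

Let opp_cts f : continuous (fun x => - f x).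
Proof. by move=> x; apply: cvgN; exact: cts_fun. Qed.

Let add_cts f g : continuous (fun x => f x + g x).
Proof. by move=> x; apply: cvgD; exact: cts_fun. Qed.

Let mul_cts f g : continuous (fun x => f x * g x).
Proof. by move=> x; apply: cvgM; exact: cts_fun. Qed.

Let zero : continuousType X R := mkcts zero_cts.
Let one : continuousType X R := mkcts one_cts.
Let opp f : continuousType X R := mkcts (opp_cts (f := f)).
Let add f g : continuousType X R := mkcts (add_cts (f := f) (g := g)).
Let mul f g : continuousType X R := mkcts (mul_cts (f := f) (g := g)).

Let addA : associative add.
Proof. by move=> f g h; apply/continuousEP => x; exact: addrA. Qed.

Let addC : commutative add.
Proof. by move=> f g; apply/continuousEP => x; exact: addrC. Qed.

Let add0 : left_id zero add.
Proof. by move=> f; apply/continuousEP => x; exact: add0r. Qed.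

Let addN : left_inverse zero opp add.
Proof. by move=> f; apply/continuousEP => x; exact: addNr. Qed.

HB.instance Definition _ :=
  GRing.isZmodule.Build (continuousType X R) addA addC add0 addN.

Let mulA : associative mul.
Proof. by move=> f g h; apply/continuousEP => x; exact: mulrA. Qed.

Let mulC : commutative mul.
Proof. by move=> f g; apply/continuousEP => x; exact: mulrC. Qed.

Let mul1 : left_id one mul.
Proof. by move=> f; apply/continuousEP => x; exact: mul1r. Qed.

Let mulDl : left_distributive mul add.
Proof. by move=> f g h; apply/continuousEP => x; exact: mulrDl. Qed.

HB.instance Definition _ :=
  GRing.Zmodule_isComPzRing.Build (continuousType X R) mulA mulC mul1 mulDl.

HB.instance Definition _ := isPointed.Build (continuousType X R) 0.

End ring_of_continuous_functions.

(* B(f, A, eps); the supremum is taken in \bar R, so that it is +oo when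
   `|f - g| is unbounded on A and -oo when A is empty. *)
Definition cts_ball (X : topologicalType) (R : realType)
    (f : continuousType X R) (A : set X) (eps : R) :
    set (continuousType X R) :=
  [set g | (ereal_sup [set `|f x - g x|%:E | x in A] < eps%:E)%E].

(* C_K(X): an alias of C(X), same ring, topologised by the base of the sets
   B(f, A, eps) with |A| < |K| and eps > 0. *)
Definition C_card (K : Type) (Kinf : infinite_set [set: K])
  (X : topologicalType) (R : realType) : Type := continuousType X R.

Section C_card_topology.
Variables (K : Type) (Kinf : infinite_set [set: K]).
Variables (X : topologicalType) (R : realType).

HB.instance Definition _ :=
  GRing.ComPzRing.copy (C_card Kinf X R) (continuousType X R).

Let idx : set (continuousType X R * set X * R) :=
  [set i | card_lt i.1.2 [set: K] /\ 0 < i.2].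

Let base (i : continuousType X R * set X * R) : set (C_card Kinf X R) :=
  cts_ball i.1.1 i.1.2 i.2.

Let cts_ballP (f g : continuousType X R) (A : set X) (eps : R) :
  cts_ball f A eps g <->
  exists2 r, r < eps & forall x, A x -> `|f x - g x| <= r.
Proof.
rewrite /cts_ball /=; split=> [|[r reps fgr]]; last first.
  apply: (@le_lt_trans _ _ r%:E); last by rewrite lte_fin.
  by apply: ge_ereal_sup => _ [x Ax <-]; rewrite lee_fin fgr.
have ub x : A x ->
    (`|f x - g x|%:E <= ereal_sup [set `|f x - g x|%:E | x in A])%E.
  by move=> Ax; apply: ereal_sup_ubound; exists x.
move: ub; case: ereal_sup => [r| |] ub //.
- by rewrite lte_fin => reps; exists r.
- by move=> _; exists (eps - 1); [rewrite ltrBlDr ltrDl|move=> x /ub].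
Qed.

Let base_cover : \bigcup_(i in idx) base i = setT.
Proof.
apply/seteqP; split=> // f _; exists (f, set0, 1).
  by split=> //=; exact: card_lt_set0.
by apply/cts_ballP; exists 0 => // x.
Qed.

Let base_join i j t : idx i -> idx j -> base i t -> base j t ->
  exists k, [/\ idx k, base k t & base k `<=` base i `&` base j].
Proof.
move: i j => [[f A] d] [[g B] e] [/= AK d0] [/= BK e0].
move=> /cts_ballP[r rd ft] /cts_ballP[s se gt].
have m0 : 0 < Num.min (d - r) (e - s) by rewrite lt_min !subr_gt0 rd.
exists (t, A `|` B, Num.min (d - r) (e - s)); split.
- by split=> //=; exact: card_lt_setU.
- by apply/cts_ballP; exists 0 => // x _; rewrite subrr normr0.
move=> h /cts_ballP[q]; rewrite lt_min => /andP[qd qe] th; split.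
- apply/cts_ballP; exists (r + q) => [|x Ax]; first by rewrite -ltrBrDl.
  by rewrite (le_trans (ler_distD (t x) _ _))// lerD ?ft// th//; left.
- apply/cts_ballP; exists (s + q) => [|x Bx]; first by rewrite -ltrBrDl.
  by rewrite (le_trans (ler_distD (t x) _ _))// lerD ?gt// th//; right.
Qed.

HB.instance Definition _ :=
  isBaseTopological.Build (C_card Kinf X R) base_cover base_join.

End C_card_topology.

Definition homeomorphism (S T : topologicalType) (f : S -> T) : Prop :=
  exists g : T -> S,
    [/\ cancel f g, cancel g f, continuous f & continuous g].

Definition tychonoff_space (Y : topologicalType) : Prop :=
  completely_regular_space Y /\ hausdorff_space Y.

(* completely_regular_space is phrased with uniformities; it is the usual
   separation of points from closed sets by real-valued functions. *)
Lemma completely_regularP (R : realType) (Y : topologicalType) :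
  completely_regular_space Y <->
  forall (y : Y) (B : set Y), closed B -> ~ B y ->
    exists f : Y -> R, [/\ continuous f, range f `<=` `[0, 1],
      f y = 0 & forall z, B z -> f z = 1].
Proof.
split=> crY y B clB nBy.
  have /(@uniform_separatorP _ R)[f [fc f01 fy fB]] := crY _ _ clB nBy.
  exists f; split=> // [|z Bz]; first by apply: fy; exists y.
  by apply: fB; exists z.
have [f [fc f01 fy fB]] := crY _ _ clB nBy.
apply/(@uniform_separatorP _ R); exists f; split=> //.
- by move=> _ [_ -> <-].
- by move=> _ [z Bz <-]; exact: fB.
Qed.

(* Main.v *)
From HB Require Import structures.
Require Import Defs.
From mathcomp Require Import all_boot all_order all_algebra.
From mathcomp Require Import all_classical all_reals topology normedtype.
Local Open Scope classical_set_scope.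

(* Y is the image of the evaluation map X -> R^C(X), a subspace of a product of
   real lines; composition with x |-> (f x)_f is a ring isomorphism
   C(Y) -> C(X), whose inverse sends f to the projection of index f.  Any
   map S -> T, continuous or not, inducing a surjection C(T) -> C(S) by
   composition pulls balls back to balls over the direct image, which is no
   larger in cardinality; apply this to X -> Y and to a section of it. *)

Import GRing.Theory numFieldNormedType.Exports.

Lemma card_lt_image (T U K : Type) (u : T -> U) (A : set T) :
  card_lt A [set: K] -> card_lt (u @` A) [set: K].
Proof.
move=> [AK nKA]; split; first exact: card_le_trans (card_image_le u A) AK.
by move=> KuA; apply: nKA; exact: card_le_trans KuA (card_image_le u A).
Qed.

(** Both suprema range over the same set of reals. *)
Lemma preimage_cts_ball (R : realType) (S T : topologicalType) (u : S -> T)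
    (Phi : continuousType T R -> continuousType S R)
    (f : continuousType T R) (A : set S) (eps : R) :
  (forall g x, Phi g x = g (u x)) ->
  Phi @^-1` cts_ball (Phi f) A eps = cts_ball f (u @` A) eps.
Proof.
move=> PhiE; apply/funext => g; rewrite /cts_ball /preimage /mkset.
by rewrite image_comp; under eq_imagel do rewrite !PhiE.
Qed.

(** Every centre is [Phi (Psi f)], so the preimage of a basic ball is a basic ball centred at
    [Psi f]; unions follow. *)
Lemma continuous_C_card_comp (K : Type) (Kinf : infinite_set [set: K])
    (R : realType) (S T : topologicalType) (u : S -> T)
    (Phi : C_card Kinf T R -> C_card Kinf S R)
    (Psi : C_card Kinf S R -> C_card Kinf T R) :
  (forall (g : continuousType T R) x,
    (Phi g : continuousType S R) x = g (u x)) ->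
  cancel Psi Phi -> continuous Phi.
Proof.
move=> PhiE PsiK; apply/continuousP => _ [D DK <-].
exists [set (Psi i.1.1, u @` i.1.2, i.2) | i in D].
  by move=> _ [i /DK[iK i0] <-]; split=> //; exact: card_lt_image.
rewrite preimage_bigcup bigcup_image; apply: eq_bigcupr => -[[f A] eps] _ /=.
by rewrite -(preimage_cts_ball _ _ _ _ _ _ _ _ PhiE) PsiK.
Qed.

Section evaluation.
Variables (R : realType) (X : topologicalType).

(** The factors are uniform spaces so that the range inherits a uniformity, whence complete
    regularity. *)
Definition evaluation (x : X) :
  prod_topology (fun _ : continuousType X R => R : uniformType) := fun f => f x.

Definition evaluation_space : uniformType := range evaluation.

Definition to_evaluation_space (x : X) : evaluation_space :=
  SigSub (mem_set (imageT evaluation x)).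

Lemma to_evaluation_space_surj (y : evaluation_space) :
  exists x, to_evaluation_space x = y.
Proof. by case: (set_valP y) => x _ xy; exists x; exact: val_inj. Qed.

Lemma coordinate_continuous (f : continuousType X R) :
  continuous (fun y : evaluation_space => (set_val y : forall _, R) f).
Proof.
move=> y; apply: (continuous_comp (f := set_val : evaluation_space -> _)
  (g := @proj _ (fun _ => R : topologicalType) f)).
  exact: initial_continuous.
exact: proj_continuous.
Qed.

Lemma to_evaluation_space_continuous : continuous to_evaluation_space.
Proof.
(* Unfolds the subspace topology, then the product as a supremum of initial topologies; only
   continuity of each [f] remains. *)
apply: continuous_comp_initial => x; apply/cvg_sup => f.
by apply: continuous_comp_initial => z; exact: cts_fun.
Qed.

Lemma evaluation_space_tychonoff : tychonoff_space evaluation_space.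
Proof.
split=> [|p q pq]; first exact: uniform_completely_regular.
apply: val_inj; apply: functional_extensionality_dep => f.
(* Neighbourhoods of the two coordinates pull back to neighbourhoods of [p] and [q], which meet. *)
apply: Rhausdorff => A B /coordinate_continuous nA /coordinate_continuous nB.
by have [y [Ay By]] := pq _ _ nA nB; exists ((set_val y : forall _, R) f).
Qed.

Definition pullback (g : continuousType evaluation_space R) :
    continuousType X R :=
  mkcts (fun x => continuous_comp (to_evaluation_space_continuous x)
                    (cts_fun (s := g) (to_evaluation_space x))).

Definition coordinate (f : continuousType X R) :
    continuousType evaluation_space R :=
  mkcts (coordinate_continuous f).

Lemma coordinateK : cancel coordinate pullback.
Proof. by move=> f; apply/continuousEP. Qed.

(** Each point is the evaluation at some [x], and its coordinate of index [pullback g] is [g] at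
    that point. *)
Lemma pullbackK : cancel pullback coordinate.
Proof.
move=> g; apply/continuousEP => y.
by have [x <-] := to_evaluation_space_surj y.
Qed.

Lemma pullback_is_zmod_morphism : zmod_morphism pullback.
Proof. by move=> g h; apply/continuousEP. Qed.

Lemma pullback_is_monoid_morphism : monoid_morphism pullback.
Proof. by split=> [|g h]; apply/continuousEP. Qed.

HB.instance Definition _ :=
  GRing.isZmodMorphism.Build _ _ pullback pullback_is_zmod_morphism.
HB.instance Definition _ :=
  GRing.isMonoidMorphism.Build _ _ pullback pullback_is_monoid_morphism.

End evaluation.

Theorem theorem2p1 (R : realType) (X : topologicalType)
    (K : Type) (Kinf : infinite_set [set: K]) :
  exists2 Y : topologicalType, tychonoff_space Y &
    exists phi : {rmorphism C_card Kinf Y R -> C_card Kinf X R},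
      @homeomorphism (C_card Kinf Y R) (C_card Kinf X R) phi.
Proof.
exists (evaluation_space R X); first exact: evaluation_space_tychonoff.
exists (@pullback R X : {rmorphism _ -> _}), (@coordinate R X).
have [s sK] := choice (@to_evaluation_space_surj R X).
split; [exact: pullbackK|exact: coordinateK| |].
- exact: (@continuous_C_card_comp _ _ _ _ _ (@to_evaluation_space R X)
            _ (@coordinate R X) _ (@coordinateK R X)).
(* [coordinate] is composition with [s], which need not be continuous: [y] is the evaluation at
   [s y], so its coordinate of index [f] is [f (s y)]. *)
- apply: (@continuous_C_card_comp _ _ _ _ _ s _ (@pullback R X) _
            (@pullbackK R X)) => f y.
  by rewrite -[in LHS](sK y).
Qed.
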